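(* Let $G=(V,E)$ be a finite undirected graph with positive edge weights. Then there exists at least one locally fair fractional orientation of $G$, every vertex $v$ has the same out-degree in all locally fair fractional orientations of $G$ (so the local out-degree $\textsl{g}^*(v)$ is well-defined), and for every $v\in V$, $\textsl{g}^*(v)=\rho^*(v)$.
   Context: Edge weights are $\textsl{g}(e)>0$. A fractional orientation assigns to each edge $\overline{uv}$ nonnegative reals $\textsl{g}(u\to v),\textsl{g}(v\to u)$ summing to $\textsl{g}(\overline{uv})$; the out-degree of $u$ is $\textsl{g}(u)=\sum_v\textsl{g}(u\to v)$. It is locally fair if $\textsl{g}(u\to v)>0$ implies $\textsl{g}(u)\le\textsl{g}(v)$. The local out-degree $\textsl{g}^*(u)$ is the out-degree of $u$ in any locally fair fractional orientation. Local density: for $B\subseteq V$ and nonempty $X\subseteq V\setminus B$, let $\hat E_B(X)$ be the set of edges with one endpoint in $X$ and the other endpoint in $X\cup B$, and $\hat\rho_B(X)=\frac{1}{|X|}\sum_{e\in\hat E_B(X)}\textsl{g}(e)$. The diminishing-dense decomposition is $B_0=\emptyset\subset B_1\subset\dots\subset B_\ell=V$, where, while $B_{i-1}\ne V$, $S_i$ is a maximizer of $\hat\rho_{B_{i-1}}(X)$ over nonempty $X\subseteq V\setminus B_{i-1}$ (taken inclusion-wise largest, as in the source of this definition, Danisch–Chan–Sozio) and $B_i=B_{i-1}\cup S_i$. For $v\in S_i$, the local density is $\rho^*(v)=\hat\rho_{B_{i-1}}(S_i)$. *)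

(* Defs.v *)
From mathcomp Require Import all_boot all_order all_algebra.
From mathcomp Require Import reals.
From mathcomp Require classical_sets.

Set Implicit Arguments.
Unset Strict Implicit.
Unset Printing Implicit Defensive.

Import Order.TTheory GRing.Theory Num.Theory.
Local Open Scope ring_scope.

(* Simple graphs: an edge is a set of two vertices. The values of [weight]
   outside [edges] play no role. *)
Record wgraph (R : realType) (V : finType) := WGraph {
  edges : {set {set V}};
  weight : {set V} -> R;
  edges_card2 : forall e, e \in edges -> #|e| = 2;
  weight_gt0 : forall e, e \in edges -> 0 < weight e }.

Section Defs.
Context {R : realType} {V : finType}.
Implicit Types (G : wgraph R V) (f : V -> V -> R) (u v : V).
Implicit Types (B X Y : {set V}) (S : seq {set V}).

(* [f u v] is the part of the edge uv oriented from u to v; it is only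
   constrained, and only used, when uv is an edge. *)
Definition fractional_orientation G f : Prop :=
  forall u v, [set u; v] \in edges G ->
    0 <= f u v /\ f u v + f v u = weight G [set u; v].

Definition outdegree G f u : R := \sum_(v | [set u; v] \in edges G) f u v.

Definition locally_fair G f : Prop :=
  forall u v, [set u; v] \in edges G ->
    0 < f u v -> outdegree G f u <= outdegree G f v.

Definition fair_orientation G f : Prop :=
  fractional_orientation G f /\ locally_fair G f.

(* The out-degree of [v] in some chosen fair orientation; the default 0 is
   used only if there is none. *)
Definition local_outdegree G v : R :=
  classical_sets.xget 0
    (fun x : R => exists f, fair_orientation G f /\ x = outdegree G f v).

Definition hatE G B X : {set {set V}} :=
  [set e in edges G | [exists u in X, exists v in X :|: B, e == [set u; v]]].

Definition hatrho G B X : R := (\sum_(e in hatE G B X) weight G e) / #|X|%:R.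

Definition densest G B X : bool :=
  [&& X != set0, X \subset ~: B &
      [forall Y : {set V},
         (Y != set0) && (Y \subset ~: B) ==> (hatrho G B Y <= hatrho G B X)]].

(* A decomposition B_0 = set0, ..., B_l = V is given by its blocks
   S = [:: S_1; ...; S_l], where B_i = B_(i-1) :|: S_i: then
   [prefix_union S i] is B_i and [nth set0 S i] is S_(i+1). *)
Definition prefix_union S (i : nat) : {set V} := \bigcup_(X <- take i S) X.

(* Maximizers are closed under union, so an inclusion-maximal one is the
   largest one. *)
Definition dd_decomposition G S : Prop :=
  (forall i, (i < size S)%N ->
     maxset (densest G (prefix_union S i)) (nth set0 S i)) /\
  prefix_union S (size S) = [set: V].

(* The blocks of a decomposition partition V, so the first block containing
   [v] is the only one. *)
Definition local_density G S v : R :=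
  let i := find (fun X : {set V} => v \in X) S in
  hatrho G (prefix_union S i) (nth set0 S i).

Lemma densest_exists G B : B != [set: V] -> exists X, densest G B X.
Proof.
move=> BT; pose P := fun Y : {set V} => (Y != set0) && (Y \subset ~: B).
have P0 : P (~: B).
  by rewrite /P subxx andbT -setCT (can_eq setCK).
have [X /andP[X0 XB] Xmax] := arg_maxP (hatrho G B) P0.
by exists X; rewrite /densest X0 XB; apply/forallP => Y; apply/implyP/Xmax.
Qed.

Lemma dd_decomposition_exists G : exists S, dd_decomposition G S.
Proof.
suff H n S : (#|~: prefix_union S (size S)| <= n)%N ->
    (forall i, (i < size S)%N ->
       maxset (densest G (prefix_union S i)) (nth set0 S i)) ->
    exists S', dd_decomposition G S'.
  by apply: (H _ [::] (leqnn _)).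
elim: n S => [|n IH] S leS maxS;
  have [ST|SnT] := eqVneq (prefix_union S (size S)) setT.
- by exists S.
- by move: leS; rewrite leqn0 cards_eq0 -setCT (can_eq setCK) (negPf SnT).
- by exists S.
have [X0 X0d] := densest_exists G SnT.
have [X maxX _] := maxset_exists X0d.
have prefixE i : (i <= size S)%N ->
    prefix_union (rcons S X) i = prefix_union S i.
  by move=> iS; rewrite /prefix_union -cats1 takel_cat.
apply: (IH (rcons S X)).
  have -> : prefix_union (rcons S X) (size (rcons S X)) =
            prefix_union S (size S) :|: X.
    by rewrite /prefix_union !take_size -cats1 big_cat big_seq1.
  have /and3P[/set0Pn[x xX] /subsetP/(_ x xX)] := maxsetp maxX.
  rewrite inE => xnS _; rewrite -ltnS; apply: leq_trans leS.
  apply: proper_card; rewrite properE setCS subsetUl setCS /=.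
  by apply/subsetPn; exists x; rewrite // inE xX orbT.
move=> i; rewrite size_rcons ltnS => iS; rewrite (prefixE i iS).
have [->|iNS] := eqVneq i (size S).
  by rewrite nth_rcons ltnn eqxx.
have iltS : (i < size S)%N by rewrite ltn_neqAle iNS.
by rewrite nth_rcons iltS; apply: maxS.
Qed.

End Defs.

(* Main.v *)
Require Import Defs.
From mathcomp Require Import all_boot all_order all_algebra.
From mathcomp Require Import reals.
From mathcomp Require Import ring lra.
From mathcomp Require classical_sets.
From mathcomp Require topology normedtype derive.

(* Existence: a fractional orientation minimising the sum of the squared
   out-degrees exists by compactness, and it is locally fair because moving a
   little weight from u->v to v->u, when g(u) > g(v), would decrease the sum.

   Out-degrees: in a locally fair orientation let B be a set of vertices whose
   out-degrees exceed those of all other vertices, so that no weight leaves B,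
   and let m be the largest out-degree outside B, attained exactly on T. Then
   the weight of hatE_B(X) is at most the sum of the out-degrees over X, hence
   at most m |X|, with equality for X = T, and equality forces X to be included
   in T. Thus T is the largest maximiser of the local density, with density m,
   and B :|: T again has the property of B. By induction the out-degrees are
   the local densities, and in particular they are unique. *)

Set Implicit Arguments.
Unset Strict Implicit.
Unset Printing Implicit Defensive.

Import Order.TTheory GRing.Theory Num.Theory.
Local Open Scope ring_scope.

(** * Compactness of the space of fractional orientations *)

Section Minimizer.
Import classical_sets topology normedtype derive numFieldNormedType.Exports.
Local Open Scope classical_set_scope.

Lemma fractional_orientation_minimizer (R : realType) (V : finType)
    (G : wgraph R V) :
  exists2 f, fractional_orientation G f &
    forall g, fractional_orientation G g ->
      \sum_u outdegree G f u ^+ 2 <= \sum_u outdegree G g u ^+ 2.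
Proof.
pose T := prod_topology (fun _ : V * V => R).
pose edge p := [set p.1; p.2]%SET \in edges G.
(* Orientations are free off the edges; the value 0 there pins these coordinates, so that [A] is a
   product of segments, compact by Tychonoff. *)
pose w p := if edge p then weight G [set p.1; p.2]%SET else 0.
have w_ge0 p : 0 <= w p.
  by rewrite /w; case: ifPn => // /weight_gt0/ltW.
pose A : set T := [set x | forall p, `[0, w p]%classic (x p)].
pose C : set T := \bigcap_(p in [set p | edge p])
  (fun x : T => x p + x (p.2, p.1)) @^-1` [set w p].
pose curried (x : T) u v := x (u, v).
have projc (p : V * V) : continuous (fun x : T => x p).
  exact: (@proj_continuous (V * V)%type (fun _ => R) p).
have AC_compact : compact (A `&` C).
  apply: compact_closedI.
    apply: (@tychonoff _ (fun _ : V * V => R) (fun p => `[0, w p])) => p.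
    exact: segment_compact.
  apply: closed_bigI => p _; apply: preimage_closed; last exact: closed_eq.
  by move=> x _; exact: (@continuousD _ _ _ _ _ x (projc p x)
    (projc (p.2, p.1) x)).
have AC0 : (A `&` C) !=set0.
  exists (fun p => w p / 2); split=> [p|p /= pE].
    by rewrite /= in_itv /=; have := w_ge0 p; lra.
  have -> : w (p.2, p.1) = w p by rewrite /w /edge /= finset.setUC.
  by field.
have Phic : continuous (fun x : T => \sum_u outdegree G (curried x) u ^+ 2).
  apply: continuous_big => [|u _]; first exact: add_continuous.
  have oc : continuous (fun x : T => outdegree G (curried x) u).
    apply: continuous_big => [|v _]; first exact: add_continuous.
    exact: projc.
  by move=> x; exact: (@continuousM _ _ _ _ x (oc x) (oc x)).
have [x xAC xmin] := compact_EVT_min AC0 AC_compact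
  (continuous_subspaceT Phic).
move: xAC; rewrite inE => -[xA xC].
exists (curried x) => [u v uvE|g gG].
  split; first by have /= := xA (u, v); rewrite in_itv => /andP[].
  by have := xC (u, v) uvE; rewrite /= /w /edge /= uvE.
(* [g] may be arbitrary off the edges; cutting it to 0 there puts it in [A] and keeps its
   out-degrees. *)
pose y : T := fun p => if edge p then g p.1 p.2 else 0.
have -> : \sum_u outdegree G g u ^+ 2 =
          \sum_u outdegree G (curried y) u ^+ 2.
  apply: eq_bigr => u _; congr (_ ^+ 2); apply: eq_bigr => v uvE.
  by rewrite /curried /y /edge /= uvE.
apply: xmin; rewrite inE; split=> [p|p /= pE].
  rewrite /= in_itv /= /y /w; case: ifPn => [pE|_]; last by rewrite lexx.
  have [g0 gw] := gG _ _ pE; have [|g0' _] := gG p.2 p.1.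
    by rewrite finset.setUC.
  by rewrite g0 -gw lerDl.
have qE : edge (p.2, p.1) by rewrite /edge finset.setUC.
rewrite /y /w pE qE.
exact: (gG _ _ pE).2.
Qed.

End Minimizer.

(** * Local fairness and its link with local density *)

Section FairOrientations.
Variables (R : realType) (V : finType) (G : wgraph R V).
Implicit Types (f : V -> V -> R) (u v : V) (B X : {set V}).

Lemma edge_neq u v : [set u; v] \in edges G -> u != v.
Proof. by move=> /edges_card2; rewrite cards2; case: (u != v). Qed.

Lemma minimizer_locally_fair f : fractional_orientation G f ->
  (forall g, fractional_orientation G g ->
     \sum_u outdegree G f u ^+ 2 <= \sum_u outdegree G g u ^+ 2) ->
  locally_fair G f.
Proof.
move=> fG fmin u v uvE fuv; rewrite leNgt; apply/negP => ltvu.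
have vuE : [set v; u] \in edges G by rewrite setUC.
have uv := edge_neq uvE; have vu := edge_neq vuE.
(* Moving [eps] from u->v to v->u changes the sum of squares by [2 * eps * (eps - d)], where [d] is
   the gap between the out-degrees of [u] and [v]. The bound [d / 2] makes this negative; the bound
   [f u v] keeps the new orientation nonnegative. *)
pose eps := Order.min (f u v) ((outdegree G f u - outdegree G f v) / 2).
have eps_gt0 : 0 < eps by rewrite lt_min fuv; lra.
have eps_f : eps <= f u v by rewrite ge_min lexx.
have eps_out : eps <= (outdegree G f u - outdegree G f v) / 2.
  by rewrite ge_min lexx orbT.
pose g a b :=
  f a b + eps * (((a == v) && (b == u))%:R - ((a == u) && (b == v))%:R).
have guv : g u v = f u v - eps by rewrite /g !eqxx (negPf uv) /=; ring.
have gvu : g v u = f v u + eps by rewrite /g !eqxx (negPf vu) /=; ring.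
have gG : fractional_orientation G g.
  move=> a b abE; have [f0 fw] := fG a b abE; split.
    have [/andP[/eqP-> /eqP->]|/negPf abuv] := boolP ((a == u) && (b == v)).
      by rewrite guv subr_ge0.
    by rewrite /g abuv subr0 addr_ge0 // mulr_ge0 // ltW.
  by rewrite -fw /g [(b == v) && _]andbC [(b == u) && _]andbC; ring.
have outu : outdegree G g u = outdegree G f u - eps.
  rewrite /outdegree (bigD1 v) //= [in RHS](bigD1 v) //= guv.
  rewrite addrAC; congr (_ + _ - _); apply: eq_bigr => b /andP[_ bv].
  by rewrite /g (negPf bv) (negPf uv) andbF subrr mulr0 addr0.
have outv : outdegree G g v = outdegree G f v + eps.
  rewrite /outdegree (bigD1 u) //= [in RHS](bigD1 u) //= gvu.
  rewrite addrAC; congr (_ + _ + _); apply: eq_bigr => b /andP[_ bu].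
  by rewrite /g (negPf bu) (negPf vu) andbF subrr mulr0 addr0.
have outx x : x != u -> x != v -> outdegree G g x = outdegree G f x.
  move=> /negPf xu /negPf xv; apply: eq_bigr => b _.
  by rewrite /g xu xv subrr mulr0 addr0.
have := fmin g gG; rewrite leNgt => /negP; apply.
rewrite (bigD1 u) //= (bigD1 v) //=.
rewrite [ltRHS](bigD1 u) //= [X in _ < _ + X](bigD1 v) //=.
rewrite outu outv (eq_bigr (fun x => outdegree G f x ^+ 2)); last first.
  by move=> x /andP[xu xv]; rewrite outx.
rewrite !addrA ltrD2r.
nra.
Qed.

(** An edge inside [X] is counted once in each direction. An edge between [X] and [B] is counted
    only from its end in [X], which suffices because nothing flows out of [B]. *)
Lemma sum_weight_hatE f B X : fractional_orientation G f ->
  (forall u v, [set u; v] \in edges G -> u \in B -> v \notin B -> f u v = 0) ->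
  X \subset ~: B ->
  \sum_(e in hatE G B X) weight G e =
  \sum_(u in X) \sum_(v | ([set u; v] \in edges G) && (v \in X :|: B)) f u v.
Proof.
move=> fG f0 /subsetP XB.
(* Exactly two ordered pairs, [(a, b)] and [(b, a)], span the edge. *)
have weightE e : e \in edges G ->
    weight G e = \sum_(p : V * V | [set p.1; p.2] == e) f p.1 p.2.
  move=> eE.
  have /cards2P[a [b [ab eab]]] : #|e| == 2 by rewrite (edges_card2 eE).
  move: eE; rewrite {}eab => eE; have [_ <-] := fG a b eE.
  rewrite (bigD1 (a, b)) //= (bigD1 (b, a)) /=; last first.
    by rewrite setUC eqxx xpair_eqE negb_and eq_sym ab.
  rewrite big1 ?addr0 // => -[c d] /= /andP[/andP[/eqP cd nab] nba].
  have cne : c != d by apply: edge_neq; rewrite cd.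
  have /set2P[ca|ca] : c \in [set a; b] by rewrite -cd set21.
    have /set2P[db|db] : d \in [set a; b] by rewrite -cd set22.
      by move: cne; rewrite ca db eqxx.
    by move: nab; rewrite ca db eqxx.
  have /set2P[db|db] : d \in [set a; b] by rewrite -cd set22.
    by move: nba; rewrite ca db eqxx.
  by move: cne; rewrite ca db eqxx.
have hatE_edge e : e \in hatE G B X -> e \in edges G by rewrite inE => /andP[].
rewrite (eq_bigr _ (fun e eE => weightE e (hatE_edge e eE))).
transitivity (\sum_(p : V * V | [set p.1; p.2] \in hatE G B X) f p.1 p.2).
  rewrite [RHS](partition_big (fun p : V * V => [set p.1; p.2])
    (mem (hatE G B X))) //=.
  apply: eq_bigr => e eE; apply: eq_bigl => p.
  by case: eqP => [->|]; rewrite ?andbF ?andbT // eE.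
rewrite pair_big_dep /= big_mkcond [RHS]big_mkcond /=.
apply: eq_bigr => -[u v] _ /=.
have [uvE|uvE] := boolP ([set u; v] \in edges G); last first.
  by rewrite inE (negPf uvE) andbF.
rewrite inE uvE /=.
have [uX /=|uX /=] := boolP (u \in X).
  have [vXB|vXB] := boolP (v \in X :|: B).
    case: ifPn => // /existsP[]; exists u; rewrite uX.
    by apply/existsP; exists v; rewrite vXB eqxx.
  case: ifPn => // /existsP[a /andP[aX /existsP[b /andP[bXB /eqP uvab]]]].
  have /set2P[vE|vE] : v \in [set a; b] by rewrite -uvab set22.
    by move: vXB; rewrite vE inE aX.
  by move: vXB; rewrite vE bXB.
(* With [u] outside [X], an edge of [hatE G B X] must go from [u] in [B] to [v] in [X], where [f]
   vanishes. *)
case: ifPn => // /existsP[a /andP[aX /existsP[b /andP[bXB /eqP uvab]]]].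
have /set2P[ua|ub] : u \in [set a; b] by rewrite -uvab set21.
  by move: uX; rewrite ua aX.
have /set2P[au|av] : a \in [set u; v] by rewrite uvab set21.
  by move: uX; rewrite -au aX.
apply: f0 => //; last by have := XB _ aX; rewrite av inE.
by move: bXB; rewrite -ub inE (negPf uX).
Qed.

(** The invariant of the induction on blocks; strictness is what lets fairness forbid flow out of
    [B]. *)
Definition superlevel f B : Prop :=
  forall u v, u \in B -> v \notin B -> outdegree G f v < outdegree G f u.

(** Inclusion-maximality of [X] is essential for the second conclusion: a smaller maximizer would
    leave vertices of the same out-degree outside [B :|: X]. *)
Lemma densest_block f B X : fair_orientation G f -> superlevel f B ->
  maxset (densest G B) X ->
  (forall v, v \in X -> outdegree G f v = hatrho G B X) /\
  superlevel f (B :|: X).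
Proof.
move=> [fG fair] Blev /maxsetP[Xdense Xmax].
have f0 u v : [set u; v] \in edges G -> u \in B -> v \notin B -> f u v = 0.
  move=> uvE uB vB; have [fuv _] := fG u v uvE.
  apply/eqP; rewrite eq_le fuv andbT leNgt; apply/negP => /(fair u v uvE).
  by rewrite leNgt Blev.
have /and3P[/set0Pn[x0 x0X] XB /forallP Xge] := Xdense.
have x0B : x0 \notin B by have := subsetP XB _ x0X; rewrite inE.
have [t tB tmax] :=
  @arg_maxP _ _ _ x0 (fun v => v \notin B) (outdegree G f) x0B.
set m := outdegree G f t in tmax.
have {}tmax v : v \notin B -> outdegree G f v <= m by move=> /tmax.
pose T := [set v in ~: B | outdegree G f v == m].
have TB : T \subset ~: B by apply/subsetP => v; rewrite inE => /andP[].
have tT : t \in T by rewrite !inE tB eqxx.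
have card_gt0R (Y : {set V}) : Y != set0 -> 0 < #|Y|%:R :> R.
  by rewrite ltr0n card_gt0.
have le_out (Y : {set V}) : Y \subset ~: B ->
    \sum_(e in hatE G B Y) weight G e <= \sum_(u in Y) outdegree G f u.
  move=> YB; rewrite (sum_weight_hatE fG f0 YB); apply: ler_sum => u _.
  rewrite [leRHS](bigID (fun v => v \in Y :|: B)) /= lerDl.
  by apply: sumr_ge0 => v /andP[/fG[]].
have out_le_m (Y : {set V}) u : Y \subset ~: B -> u \in Y -> outdegree G f u <= m.
  by move=> /subsetP YB /YB; rewrite inE => /tmax.
have T0 : T != set0 by apply/set0Pn; exists t.
(* The bound [le_out] is tight for [T]: a vertex outside [T :|: B] has out-degree below [m], so
   fairness lets nothing flow to it from [T]. *)
have rhoT : hatrho G B T = m.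
  rewrite /hatrho (sum_weight_hatE fG f0 TB).
  rewrite (eq_bigr (fun=> m)); last first.
    move=> u uT; have := uT; rewrite inE => /andP[uB /eqP <-].
    rewrite /outdegree [RHS](bigID (fun v => v \in T :|: B)) /=.
    rewrite [X in _ + X]big1 ?addr0 // => v /andP[uvE vTB].
    have [fuv _] := fG u v uvE; apply/eqP; rewrite eq_le fuv andbT leNgt.
    apply/negP => /(fair u v uvE); apply/negP; rewrite -ltNge.
    move: vTB uT; rewrite !inE negb_or negb_and negbK.
    case: (boolP (v \in B)) => //= vB; rewrite andbT => vm /andP[_ /eqP ->].
    by rewrite lt_neqAle vm tmax.
  by rewrite sumr_const -(mulr_natr m) mulfK // gt_eqF ?card_gt0R.
have rhole (Y : {set V}) : Y != set0 -> Y \subset ~: B -> hatrho G B Y <= m.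
  move=> Y0 YB; rewrite ler_pdivrMr ?card_gt0R //.
  apply: le_trans (le_out _ YB) _.
  rewrite mulr_natr -sumr_const; apply: ler_sum => u; exact: out_le_m.
have Tdense : densest G B T.
  apply/and3P; split=> //; apply/forallP => Y; apply/implyP => /andP[Y0 YB].
  by rewrite rhoT rhole.
have X0 : X != set0 by apply/set0Pn; exists x0.
have rhoX : hatrho G B X = m.
  apply/eqP; rewrite eq_le rhole //= -rhoT.
  by have /implyP := Xge T; apply; rewrite T0 TB.
have outX u : u \in X -> outdegree G f u = m.
  move=> uX; apply/eqP; rewrite eq_sym -subr_eq0.
  have sub_ge0 v : v \in X -> 0 <= m - outdegree G f v.
    by move=> vX; rewrite subr_ge0 (out_le_m X).
  (* Density [m] means that the edges of [X] weigh [m * #|X|], which [le_out] bounds by the sum of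
     the out-degrees; hence the nonnegative gaps sum to 0. *)
  have : \sum_(v in X) (m - outdegree G f v) == 0.
    rewrite eq_le sumr_ge0 // andbT sumrB sumr_const subr_le0.
    apply: le_trans (le_out _ XB).
    by rewrite -(mulr_natr m) -rhoX divfK // gt_eqF ?card_gt0R.
  by rewrite psumr_eq0 // => /allP/(_ u); rewrite mem_index_enum uX; apply.
have XT : X = T.
  apply/esym/Xmax => //; apply/subsetP => u uX.
  by rewrite !inE (outX u uX) eqxx andbT -in_setC (subsetP XB).
split=> [v vX|u v]; first by rewrite outX.
rewrite !inE negb_or => /orP[uB|uX] /andP[vB vX]; first exact: Blev.
rewrite (outX _ uX) lt_neqAle tmax // andbT.
by move: vX; rewrite XT !inE vB.
Qed.

Lemma in_bigcup_seq v (S : seq {set V}) :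
  (v \in \bigcup_(X <- S) X) = has (fun X : {set V} => v \in X) S.
Proof.
by elim: S => [|X S IH]; rewrite ?big_nil ?big_cons inE //= IH.
Qed.

Lemma outdegree_local_density f S : fair_orientation G f ->
  dd_decomposition G S -> forall v, outdegree G f v = local_density G S v.
Proof.
move=> fairf [Smax ST] v.
have lev i : (i <= size S)%N -> superlevel f (prefix_union S i).
  elim: i => [_ u w|i IH iS]; first by rewrite /prefix_union take0 big_nil inE.
  have -> : prefix_union S i.+1 = prefix_union S i :|: nth set0 S i.
    by rewrite /prefix_union (take_nth set0) // -cats1 big_cat big_seq1.
  by have [] := densest_block fairf (IH (ltnW iS)) (Smax i iS).
(* The blocks cover all vertices, so [find] returns a valid index. *)
have hasv : has (fun X : {set V} => v \in X) S.
  by rewrite -in_bigcup_seq -{1}[S]take_size -/(prefix_union _ _) ST inE.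
have iS := hasv; rewrite has_find in iS.
have [-> //] := densest_block fairf (lev _ (ltnW iS)) (Smax _ iS).
exact: (nth_find set0 hasv).
Qed.

End FairOrientations.

Theorem theorem9 (R : realType) (V : finType) (G : wgraph R V) :
  (exists f : V -> V -> R, fair_orientation G f) /\
  (forall f h : V -> V -> R, fair_orientation G f -> fair_orientation G h ->
     forall v : V, outdegree G f v = outdegree G h v) /\
  (forall S : seq {set V}, dd_decomposition G S ->
     forall v : V, local_outdegree G v = local_density G S v).
Proof.
have fair_exists : exists f : V -> V -> R, fair_orientation G f.
  have [f fG fmin] := fractional_orientation_minimizer G.
  by exists f; split=> //; apply: minimizer_locally_fair.
split=> //; split=> [f h fG hG v|S SG v].
  (* Both out-degrees equal the local density of one common decomposition. *)
  have [S SG] := dd_decomposition_exists G.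
  by rewrite !(outdegree_local_density _ SG).
(* The case where [xget] falls back on its default contradicts existence. *)
rewrite /local_outdegree; case: classical_sets.xgetP => [x _ [f [fG ->]]|none].
  exact: outdegree_local_density.
have [f fG] := fair_exists.
by case: (none (outdegree G f v)); exists f.
Qed.
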